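(* Assume that, for every natural number $N$, the derivative $\frac{\partial^{N+1}}{\partial t^{N+1}} f(t,s,x,u)$ is continuous in $t$ and satisfies $\left|\frac{\partial^{N+1}}{\partial t^{N+1}} f(t,s,x,u)\right|\le M_N$ for all relevant values of $t,s,x,u$, where $M_N$ is a constant; that $f$ is Lipschitz in $x$ with constant $L_0$, uniformly in the other variables; and that $F(t,x,u)$ and $F_0(x)$ are Lipschitz in $x$, uniformly in the other variables, with Lipschitz constants $L_F$ and $L_{F_0}$ respectively. Let $u^*_{\varepsilon,N}(\cdot)\in U_{ad}$ be an $\varepsilon$-suboptimal control with respect to $J_{[N]}$, i.e. $J_{[N]}(u^*_{\varepsilon,N}(\cdot))\le J^*_{[N]}+\varepsilon$. Then $$J(u^*_{\varepsilon,N}(\cdot))-\varepsilon-2\omega_N(T)\le J^*\le J(u^*_{\varepsilon,N}(\cdot)),$$ and, as a consequence, the sequence $\{J(u^*_{\varepsilon,N}(\cdot)):N=1,2,\dots\}$ converges to $J^*$ as $N\to\infty$.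
   Context: $T>0$ is fixed; $x_0:[0,T]\to\mathbb{R}$ is a given function; $U_{ad}$ is the class of admissible control functions; $f(t,s,x,u)$, $F(t,x,u)$ and $F_0(x)$ are real-valued, where $t,s\in[0,T]$, $x$ is the real state variable and $u$ is the control variable. For each $N$, $f_{[N]}(t,s,x,u)=\sum_{j=0}^N t^j f_j(s,x,u)$ is the polynomial (in $t$) approximation to $f$ for which $f=f_{[N]}+R_N$ with $|R_N(t,s,x,u)|\le \frac{M_N t^{N+1}}{(N+1)!}$ for all relevant values of $t,s,x,u$. For $u(\cdot)\in U_{ad}$, $x$ and $x_{[N]}$ are defined as the solutions on $[0,T]$ of $$x(t)=x_0(t)+\int_0^t f(t,s,x(s),u(s))\,ds,\qquad x_{[N]}(t)=x_0(t)+\int_0^t f_{[N]}(t,s,x_{[N]}(s),u(s))\,ds,$$ and $$J(u(\cdot))=\int_0^T F(t,x(t),u(t))\,dt+F_0(x(T)),\qquad J_{[N]}(u(\cdot))=\int_0^T F(t,x_{[N]}(t),u(t))\,dt+F_0(x_{[N]}(T)).$$ The optimal values are $J^*=\inf_{u(\cdot)\in U_{ad}}J(u(\cdot))$ and $J^*_{[N]}=\inf_{u(\cdot)\in U_{ad}}J_{[N]}(u(\cdot))$. Finally, $$\omega_N(T)=L_F M_N\left[\frac{\exp(L_0T)-1-L_0T}{L_0^{N+3}}-\sum_{\ell=0}^N\frac{T^{N-\ell+2}}{L_0^{\ell+1}\,(N-\ell+2)!}\right]+L_{F_0}M_N\left[\frac{\exp(L_0T)-1}{L_0^{N+2}}-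\sum_{\ell=0}^N\frac{T^{N-\ell+1}}{L_0^{\ell+1}\,(N-\ell+1)!}\right].$$
   Formalization: The bound with ω_N is proved if |R_N| ≤ M_N(t-s)^{N+1}/(N+1)! for s ≤ t; under the stated bound on R_N, ω_N becomes (N+2)ω_N. If M_N T^{N+1}/(N+1)! → 0, J(u* ) → J* is proved for ε_N → 0; for fixed ε only J* ≤ J(u* ) ≤ J*+ε+η for large N. L_0 > 0. *)

(* Defs.v *)
(* MathComp-Analysis: R is an arbitrary realType, integrals are Lebesgue. *)
From mathcomp Require Export all_boot all_order all_algebra.
From mathcomp Require Export all_classical all_reals all_analysis.
Export Order.TTheory GRing.Theory Num.Theory numFieldNormedType.Exports.
Set Implicit Arguments.
Unset Strict Implicit.
Unset Printing Implicit Defensive.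
Local Open Scope classical_set_scope.
Local Open Scope ring_scope.

(* The kernel is only given for t in [0, T], so its t-derivatives are one-sided
   at the end points; [within] expresses this without extending the kernel
   outside the interval. *)
Definition is_derive_in (R : realType) (T : R) (g g' : R -> R) : Prop :=
  forall t : R, t \in `[0, T] ->
    (g y - g t) / (y - t) @[y --> within `[0, T] t^'] --> g' t.

Fixpoint is_derive_n_in (R : realType) (T : R) (n : nat) (g h : R -> R) : Prop :=
  match n with
  | 0%N => forall t : R, t \in `[0, T] -> h t = g t
  | m.+1 => exists k : R -> R, is_derive_n_in T m g k /\ is_derive_in T k h
  end.

Definition poly_kernel (R : realType) (U : Type) (c : nat -> R -> R -> U -> R)
    (N : nat) (t s x : R) (u : U) : R :=
  \sum_(j < N.+1) t ^+ j * c j s x u.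

(* Integrability of x and of the integrand is part of being a solution: without
   it [Rintegral] would return a junk value. *)
Definition volterra_solution (R : realType) (U : Type) (T : R) (x0 : R -> R)
    (f : R -> R -> R -> U -> R) (u : R -> U) (x : R -> R) : Prop :=
  (@lebesgue_measure R).-integrable `[0, T] (EFin \o x) /\
  forall t : R, t \in `[0, T] ->
    (@lebesgue_measure R).-integrable `[0, t] (fun s => (f t s (x s) (u s))%:E) /\
    x t = x0 t + \int[@lebesgue_measure R]_(s in `[0, t]) f t s (x s) (u s).

Definition running_cost_integrable (R : realType) (U : Type) (T : R)
    (F : R -> R -> U -> R) (u : R -> U) (x : R -> R) : Prop :=
  (@lebesgue_measure R).-integrable `[0, T] (fun t => (F t (x t) (u t))%:E).

Definition cost (R : realType) (U : Type) (T : R) (F : R -> R -> U -> R)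
    (F0 : R -> R) (x : (R -> U) -> R -> R) (u : R -> U) : R :=
  \int[@lebesgue_measure R]_(t in `[0, T]) F t (x u t) (u t) + F0 (x u T).

(* Extended-real valued: the infimum may be -oo. *)
Definition optval (R : realType) (U : Type) (Uad : set (R -> U))
    (J : (R -> U) -> R) : \bar R :=
  ereal_inf [set (J u)%:E | u in Uad].

Definition suboptimal (R : realType) (U : Type) (Uad : set (R -> U))
    (J : (R -> U) -> R) (eps : R) (u : R -> U) : Prop :=
  Uad u /\ ((J u)%:E <= optval Uad J + eps%:E)%E.

Definition omega (R : realType) (L0 LF LF0 T : R) (M : nat -> R) (N : nat) : R :=
  LF * M N * ((expR (L0 * T) - 1 - L0 * T) / L0 ^+ (N + 3)
              - \sum_(l < N.+1) T ^+ (N - l + 2)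
                                / (L0 ^+ l.+1 * ((N - l + 2)`!)%:R))
  + LF0 * M N * ((expR (L0 * T) - 1) / L0 ^+ (N + 2)
              - \sum_(l < N.+1) T ^+ (N - l + 1)
                                / (L0 ^+ l.+1 * ((N - l + 1)`!)%:R)).

(* Main.v *)
(* Subtracting the two Volterra equations, the error [e t = `|x t - y t|]
   satisfies [e t <= ∫_0^t r t s ds + L0 * ∫_0^t e], where [r] bounds the
   remainder of the kernel.  In both cases the first integral is
   [K * t ^+ N.+2 / (N.+2)`!], with [K = M N] for the remainder in
   [(t - s) ^+ N.+1] and [K = N.+2 * M N] for the one in [t ^+ N.+1], so Gronwall
   bounds [e] by the solution of [y t = K * t ^+ N.+2 / (N.+2)`! + L0 * ∫_0^t y],
   a tail of the exponential series.  Combining its integral over [0, T] and its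
   value at T with the Lipschitz constants gives exactly [omega N], resp.
   [N.+2 * omega N], as a bound on [`|J - JN|] uniform over the controls, and
   such a bound transfers suboptimality from [JN] to [J]. *)
Require Import Defs.
From mathcomp Require Import ring lra.
Local Open Scope classical_set_scope.
Local Open Scope ring_scope.

Section IntegralFromZero.
Context {R : realType}.
Implicit Types (f F : R -> R) (t : R) (n : nat).
Local Notation mu := (@lebesgue_measure R).

Lemma continuous_integrable_itv f (a b : R) :
  continuous f -> mu.-integrable `[a, b] (EFin \o f).
Proof.
move=> cf; apply: continuous_compact_integrable; first exact: segment_compact.
exact: continuous_subspaceT.
Qed.

Lemma Rintegral_antiderivative [F f t] :
  (forall s : R, is_derive s 1 F (f s)) -> continuous f -> 0 <= t ->
  \int[mu]_(s in `[0, t]) f s = F t - F 0.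
Proof.
move=> dF cf; rewrite le_eqVlt => /predU1P[<-|t0].
  by rewrite set_itv1 Rintegral_set1 subrr.
have dF1 s : derivable F s 1 by case: (dF s).
have cF : continuous F.
  by move=> s; apply/differentiable_continuous/derivable1_diffP/dF1.
rewrite /Rintegral (@continuous_FTC2 _ _ F)//.
- exact: continuous_subspaceT.
- by split => [s _||]; [exact: dF1|apply: cvg_at_right_filter; exact: cF|
    apply: cvg_at_left_filter; exact: cF].
- by move=> s _; rewrite derive1E; apply: derive_val.
Qed.

Lemma Rintegral_const (k : R) t : 0 <= t ->
  \int[mu]_(s in `[0, t]) k = k * t.
Proof.
have dF (s : R) : is_derive s 1 (k \*: id : R -> R) k.
  by apply: (is_derive_eq (is_deriveZ k (is_derive_id s 1))); exact: mulr1.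
move=> t0; rewrite (Rintegral_antiderivative dF)//.
  by rewrite /= scaler0 subr0.
by move=> s; exact: cvg_cst.
Qed.

Lemma is_derive_monomial n t :
  is_derive t 1 (fun s => s ^+ n.+1 / (n.+1)`!%:R) (t ^+ n / n`!%:R).
Proof.
have -> : (fun s => s ^+ n.+1 / (n.+1)`!%:R) =
    ((n.+1)`!%:R : R)^-1 \*: ((id : R -> R) ^+ n.+1).
  by apply/funext => s; rewrite mulrC /= exprfctE.
apply: is_derive_eq.
rewrite factS natrM /GRing.scale/= mulr1 invfM mulrACA mulVf ?pnatr_eq0// mul1r.
exact: mulrC.
Qed.

Lemma continuous_monomial n : continuous (fun s : R => s ^+ n / n`!%:R).
Proof.
move=> s; apply: cvgM; last exact: cvg_cst.
exact: exprn_continuous.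
Qed.

Lemma Rintegral_monomial n t : 0 <= t ->
  \int[mu]_(s in `[0, t]) (s ^+ n / n`!%:R) = t ^+ n.+1 / (n.+1)`!%:R.
Proof.
move=> t0; rewrite (Rintegral_antiderivative (is_derive_monomial n))//.
  by rewrite expr0n mul0r subr0.
exact: continuous_monomial.
Qed.

Lemma continuous_shifted_monomial n t :
  continuous (fun s : R => (t - s) ^+ n / n`!%:R).
Proof.
move=> s.
apply: (@continuous_comp _ _ _ (fun s => t - s) (fun s => s ^+ n / n`!%:R)).
  by apply: cvgB => //; exact: cvg_cst.
exact: continuous_monomial.
Qed.

Lemma Rintegral_shifted_monomial n t : 0 <= t ->
  \int[mu]_(s in `[0, t]) ((t - s) ^+ n / n`!%:R) = t ^+ n.+1 / (n.+1)`!%:R.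
Proof.
move=> t0; pose F s := - ((t - s) ^+ n.+1 / (n.+1)`!%:R).
have dF (s : R) : is_derive s 1 F ((t - s) ^+ n / n`!%:R).
  have -> : F = - ((fun s => s ^+ n.+1 / (n.+1)`!%:R) \o (cst t - id)) by [].
  have h : is_derive s 1 (cst t - id : R -> R) (0 - 1) by exact: is_deriveB.
  have := is_deriveN
    (is_derive1_comp (is_derive_monomial n ((cst t - id : R -> R) s)) h).
  by rewrite sub0r mulrN1 opprK.
rewrite (Rintegral_antiderivative dF)//.
  by rewrite /F subrr subr0 expr0n mul0r oppr0 sub0r opprK.
exact: continuous_shifted_monomial.
Qed.

End IntegralFromZero.

(* [exp_tail L n t] is the sum over [k] of [L ^+ k * t ^+ (n + k) / (n + k)`!]:
   the exponential series of [L * t] without its first [n] terms, divided by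
   [L ^+ n]. *)
Fixpoint exp_tail {R : realType} (L : R) (n : nat) (t : R) : R :=
  if n is m.+1 then (exp_tail L m t - t ^+ m / m`!%:R) / L else expR (L * t).

Section ExpTail.
Set Implicit Arguments.
Unset Strict Implicit.
Context {R : realType} (L : R) (L_gt0 : 0 < L).
Local Notation mu := (@lebesgue_measure R).

Lemma exp_tailS n t :
  exp_tail L n t = t ^+ n / n`!%:R + L * exp_tail L n.+1 t.
Proof. by rewrite /= [L * _]mulrC divfK ?gt_eqF// addrC subrK. Qed.

Lemma exp_tailE n t : exp_tail L n t =
  expR (L * t) / L ^+ n
  - \sum_(l < n) t ^+ (n.-1 - l) / (L ^+ l.+1 * (n.-1 - l)`!%:R).
Proof.
elim: n => [|n IH]; first by rewrite big_ord0 expr0 divr1 subr0.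
rewrite big_ord_recl subn0 expr1 exprSr /= IH.
have -> : \sum_(l < n) t ^+ (n - bump 0 l) /
      (L ^+ (bump 0 l).+1 * (n - bump 0 l)`!%:R) =
    (\sum_(l < n) t ^+ (n.-1 - l) / (L ^+ l.+1 * (n.-1 - l)`!%:R)) / L.
  rewrite mulr_suml; apply: eq_bigr => l _.
  rewrite /bump add1n (_ : n.-1 - l = n - l.+1)%N; last first.
    by rewrite -subn1 -subnDA.
  by rewrite [L ^+ l.+2]exprS !invfM; ring.
by rewrite !invfM; ring.
Qed.

Lemma is_derive_exp_tail n (t : R) :
  is_derive t 1 (exp_tail L n.+1) (exp_tail L n t).
Proof.
elim: n t => [|n IH] t.
  have -> : exp_tail L 1 = L^-1 \*: ((expR \o (L \*: id)) - cst 1).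
    by apply/funext => s /=; rewrite expr0 fact0 divr1 mulrC.
  have h : is_derive t 1 (L \*: id : R -> R) (L *: 1) by exact: is_deriveZ.
  have h' := is_deriveZ L^-1 (is_deriveB
    (is_derive1_comp (is_derive_expR ((L \*: id : R -> R) t)) h)
    (is_derive_cst (1 : R) t 1)).
  apply: (is_derive_eq h').
  by rewrite subr0 /GRing.scale/= mulr1 mulrCA mulVf ?gt_eqF// mulr1.
have -> : exp_tail L n.+2 =
    L^-1 \*: (exp_tail L n.+1 - (fun s => s ^+ n.+1 / (n.+1)`!%:R)).
  by apply/funext => s; rewrite /= mulrC.
apply: (is_derive_eq
  (is_deriveZ L^-1 (is_deriveB (IH t) (is_derive_monomial n t)))).
by rewrite /GRing.scale/= mulrC.
Qed.

Lemma continuous_exp_tail n : continuous (exp_tail L n).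
Proof.
case: n => [|n] t.
  apply: (@continuous_comp _ _ _ ( *%R L) expR); last exact: continuous_expR.
  exact: mulrl_continuous.
apply/differentiable_continuous/derivable1_diffP.
by case: (is_derive_exp_tail n t).
Qed.

Lemma exp_tail0 n : exp_tail L n.+1 0 = 0.
Proof.
elim: n => [|n IH].
  by rewrite /= mulr0 expR0 expr0 fact0 divr1 subrr mul0r.
by rewrite -[LHS]/((exp_tail L n.+1 0 - 0 ^+ n.+1 / (n.+1)`!%:R) / L) IH expr0n
  !mul0r subr0 mul0r.
Qed.

Lemma Rintegral_exp_tail n t : 0 <= t ->
  \int[mu]_(s in `[0, t]) exp_tail L n s = exp_tail L n.+1 t.
Proof.
move=> t0; rewrite (Rintegral_antiderivative (is_derive_exp_tail n))//.
  by rewrite exp_tail0 subr0.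
exact: continuous_exp_tail.
Qed.

Lemma exp_tail_le n t : 0 <= t ->
  exp_tail L n t <= t ^+ n / n`!%:R * expR (L * t).
Proof.
elim: n t => [|n IH] t t0; first by rewrite expr0 fact0 divr1 mul1r.
rewrite -Rintegral_exp_tail// -Rintegral_monomial//.
rewrite -RintegralZr//; last first.
  exact/continuous_integrable_itv/continuous_monomial.
apply: le_Rintegral => //.
- exact/continuous_integrable_itv/continuous_exp_tail.
- apply: continuous_integrable_itv => s; apply: cvgM; last exact: cvg_cst.
  exact: continuous_monomial.
- move=> s /=; rewrite in_itv/= => /andP[s0 st].
  apply: le_trans (IH s s0) _; apply: ler_wpM2l.
    by rewrite divr_ge0// exprn_ge0.
  by rewrite ler_expR ler_pM2l.
Qed.

End ExpTail.

Section Gronwall.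
Set Implicit Arguments.
Unset Strict Implicit.
Context {R : realType} (L T : R) (L_gt0 : 0 < L).
Local Notation mu := (@lebesgue_measure R).

Lemma integrable_itvS (f : R -> R) (t : R) : t \in `[0, T] ->
  mu.-integrable `[0, T] (EFin \o f) -> mu.-integrable `[0, t] (EFin \o f).
Proof.
rewrite in_itv/= => /andP[t0 tT]; apply: integrableS => //.
exact: subset_itvl.
Qed.

(* [d] need not be continuous, so rather than differentiating its integral the
   inequality is iterated: [d t] is at most [C * (L * t) ^+ n / n`!]. *)
Lemma gronwall_homogeneous (d : R -> R) :
  mu.-integrable `[0, T] (EFin \o d) ->
  (forall t, t \in `[0, T] -> d t <= L * \int[mu]_(s in `[0, t]) d s) ->
  forall t, t \in `[0, T] -> d t <= 0.
Proof.
move=> id dle.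
pose C := L * \int[mu]_(s in `[0, T]) `|d s|.
have step n t : t \in `[0, T] -> d t <= C * L ^+ n * (t ^+ n / n`!%:R).
  elim: n t => [|n IH] t tT; have := tT; rewrite in_itv/= => /andP[t0 t_le].
    rewrite !expr0 fact0 divr1 !mulr1; apply: le_trans (dle t tT) _.
    rewrite ler_pM2l//; apply: le_trans (ler_norm _) _.
    have idt := integrable_itvS tT id.
    apply: le_trans (le_normr_Rintegral _ idt) _ => //.
    rewrite /Rintegral fine_le//.
    - apply: integrable_fin_num => //.
      by apply: (integrable_norm (integrable_itvS tT id)).
    - by apply: integrable_fin_num => //; apply: (integrable_norm id).
    - apply: ge0_subset_integral => //; last exact: subset_itvl.
      by have /integrableP[] := integrable_norm id.
  apply: le_trans (dle t tT) _.
  rewrite exprSr mulrA mulrAC [leRHS]mulrC ler_pM2l//.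
  rewrite -Rintegral_monomial// -RintegralZl//; last first.
    exact/continuous_integrable_itv/continuous_monomial.
  apply: le_Rintegral => //; first exact: integrable_itvS.
    apply: continuous_integrable_itv => s; apply: cvgM; first exact: cvg_cst.
    exact: continuous_monomial.
  move=> s /=; rewrite in_itv/= => /andP[s0 st]; apply: IH.
  by rewrite in_itv/= s0 (le_trans st).
move=> t tT.
have cv : (C * exp_coeff (L * t) n) @[n --> \oo] --> (0 : R).
  by rewrite -[X in _ --> X](mulr0 C); apply: cvgMl_tmp; exact: cvg_exp_coeff.
rewrite -(cvg_lim _ cv)//; apply: limr_ge; first by apply/cvg_ex; exists 0.
near=> n; apply: le_trans (step n t tT) _.
by rewrite /exp_coeff /= exprMn !mulrA.
Unshelve. all: by end_near. Qed.

Lemma gronwall_monomial (K : R) (n : nat) (e : R -> R) :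
  mu.-integrable `[0, T] (EFin \o e) ->
  (forall t, t \in `[0, T] ->
     e t <= K * (t ^+ n / n`!%:R) + L * \int[mu]_(s in `[0, t]) e s) ->
  forall t, t \in `[0, T] -> e t <= K * exp_tail L n t.
Proof.
move=> ie ele t tT; rewrite -subr_le0.
pose y s := K * exp_tail L n s.
have iy (a : R) : mu.-integrable `[0, a] (EFin \o y).
  apply: continuous_integrable_itv => s; apply: cvgM; first exact: cvg_cst.
  exact: continuous_exp_tail.
apply: (@gronwall_homogeneous (fun s => e s - y s)) tT => [|{}t tT].
  exact: (integrableB _ ie (iy T)).
rewrite RintegralB//; last exact: integrable_itvS.
have := tT; rewrite in_itv/= => /andP[t0 _].
rewrite {2}/y RintegralZl//; last first.
  exact/continuous_integrable_itv/continuous_exp_tail.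
rewrite Rintegral_exp_tail// /y exp_tailS//.
by have := ele t tT; lra.
Qed.

End Gronwall.

Section ErrorEstimates.
Set Implicit Arguments.
Unset Strict Implicit.
Context {R : realType} (U : Type) (T : R) (T_gt0 : 0 < T).
Local Notation mu := (@lebesgue_measure R).

Lemma lipschitz_le (k : R) (h : R -> R) : k.-lipschitz h ->
  forall y z : R, `|h y - h z| <= k * `|y - z|.
Proof. by move=> lip y z; apply: (lip (y, z)). Qed.

Lemma lipschitz_ge0 (k : R) (h : R -> R) : k.-lipschitz h -> 0 <= k.
Proof.
move=> /lipschitz_le /(_ 1 0); rewrite subr0 normr1 mulr1.
exact: le_trans.
Qed.

Lemma trajectory_error (L K : R) (n : nat) (x0 : R -> R)
    (f g : R -> R -> R -> U -> R) (r : R -> R -> R)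
    (u : R -> U) (x y : R -> R) :
  0 < L ->
  (forall (t s : R) (v : U), t \in `[0, T] -> s \in `[0, T] ->
    L.-lipschitz (fun z : R => f t s z v)) ->
  (forall (t s z : R) (v : U), t \in `[0, T] -> s \in `[0, t] ->
    `|f t s z v - g t s z v| <= r t s) ->
  (forall t, t \in `[0, T] -> mu.-integrable `[0, t] (EFin \o r t)) ->
  (forall t, t \in `[0, T] ->
    \int[mu]_(s in `[0, t]) r t s = K * (t ^+ n / n`!%:R)) ->
  volterra_solution T x0 f u x -> volterra_solution T x0 g u y ->
  forall t, t \in `[0, T] -> `|x t - y t| <= K * exp_tail L n t.
Proof.
move=> L0 lip rem ir Ir [ix xE] [iy yE].
pose e s := `|x s - y s|.
have ie : mu.-integrable `[0, T] (EFin \o e).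
  apply: (@integrable_norm _ _ _ mu _ (fun s => x s - y s)).
  exact: (integrableB _ ix iy).
apply: (@gronwall_monomial _ _ _ L0 K n e ie) => t tT.
rewrite {1}/e; have [ifx ->] := xE t tT; have [igy ->] := yE t tT.
rewrite opprD addrACA subrr add0r -RintegralB//.
have iB : mu.-integrable `[0, t]
    (EFin \o (fun s => f t s (x s) (u s) - g t s (y s) (u s))).
  exact: (integrableB _ ifx igy).
have iet := integrable_itvS tT ie.
apply: le_trans (le_normr_Rintegral _ iB) _ => //.
have iLe : mu.-integrable `[0, t] (EFin \o (fun s => L * e s)).
  exact: (integrableZl _ L iet).
rewrite -Ir// -RintegralZl// -RintegralD//; last exact: ir.
apply: le_Rintegral => //.
- exact: (integrable_norm iB).
- exact: (integrableD _ (ir t tT) iLe).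
move=> s /= st.
rewrite -(subrKA (f t s (y s) (u s))) addrC.
apply: le_trans (ler_normD _ _) _; apply: lerD; first exact: rem.
apply: (lipschitz_le (lip t s (u s) tT _)).
move: st tT; rewrite !in_itv/= => /andP[-> st] /andP[_ tT].
exact: le_trans tT.
Qed.

Lemma cost_error (L LF LF0 K : R) (n : nat) (F : R -> R -> U -> R)
    (F0 : R -> R) (x y : (R -> U) -> R -> R) (u : R -> U) :
  0 < L ->
  (forall (t : R) (v : U), t \in `[0, T] ->
    LF.-lipschitz (fun z : R => F t z v)) ->
  LF0.-lipschitz F0 ->
  running_cost_integrable T F u (x u) -> running_cost_integrable T F u (y u) ->
  (forall t, t \in `[0, T] -> `|x u t - y u t| <= K * exp_tail L n t) ->
  `|cost T F F0 x u - cost T F F0 y u|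
    <= LF * (K * exp_tail L n.+1 T) + LF0 * (K * exp_tail L n T).
Proof.
move=> L0 Flip F0lip ix iy xy.
have TT : T \in `[0, T] by rewrite in_itv/= lexx ltW.
have LF_ge0 := lipschitz_ge0 (Flip T (u T) TT).
have LF0_ge0 := lipschitz_ge0 F0lip.
rewrite /cost opprD addrACA.
apply: le_trans (ler_normD _ _) _; apply: lerD; last first.
  apply: le_trans (lipschitz_le F0lip _ _) _.
  by rewrite ler_wpM2l//= xy.
rewrite -RintegralB//.
have iB : mu.-integrable `[0, T]
    (EFin \o (fun t => F t (x u t) (u t) - F t (y u t) (u t))).
  exact: (integrableB _ ix iy).
apply: le_trans (le_normr_Rintegral _ iB) _ => //.
have itail : mu.-integrable `[0, T] (EFin \o exp_tail L n).
  exact/continuous_integrable_itv/continuous_exp_tail.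
rewrite -(Rintegral_exp_tail L0 _ (ltW T_gt0)) mulrA -RintegralZl//.
apply: le_Rintegral => //.
- exact: (integrable_norm iB).
- exact: (integrableZl _ (LF * K) itail).
move=> t /= tT; apply: le_trans (lipschitz_le (Flip t (u t) tT) _ _) _.
by rewrite -mulrA ler_wpM2l//= xy.
Qed.

Lemma suboptimal_transfer (Uad : set (R -> U)) (J J' : (R -> U) -> R)
    (w eps : R) (u : R -> U) :
  (forall v, Uad v -> `|J v - J' v| <= w) -> suboptimal Uad J' eps u ->
  ((J u - eps - 2 * w)%:E <= optval Uad J)%E /\ (optval Uad J <= (J u)%:E)%E.
Proof.
move=> JJ' [Uu Ju]; split; last by apply: ereal_inf_lbound; exists u.
apply: le_ereal_inf_tmp => _ [v Uv <-]; rewrite lee_fin.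
have : ((J' u)%:E <= (J' v)%:E + eps%:E)%E.
  apply: le_trans Ju _; rewrite leeD2r//.
  by apply: ereal_inf_lbound; exists v.
rewrite -EFinD lee_fin => J'uv.
have := JJ' u Uu; have := JJ' v Uv; rewrite !ler_norml => /andP[? ?] /andP[? ?].
lra.
Qed.

Lemma omegaE (L0 LF LF0 : R) (M : nat -> R) (N : nat) : 0 < L0 ->
  omega L0 LF LF0 T M N =
    LF * (M N * exp_tail L0 N.+3 T) + LF0 * (M N * exp_tail L0 N.+2 T).
Proof.
move=> L0_gt0; have L0n0 := gt_eqF L0_gt0.
have low p :
    \sum_(l < N.+1) T ^+ (N - l + p) / (L0 ^+ l.+1 * (N - l + p)`!%:R) =
    \sum_(l < N.+1) T ^+ (N + p - l) / (L0 ^+ l.+1 * (N + p - l)`!%:R).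
  by apply: eq_bigr => l _; rewrite addnBAC// -ltnS.
rewrite /omega !low addn1 addn2 addn3 !exp_tailE//=.
rewrite [\sum_(l < N.+3) _]big_ord_recr.
rewrite [\sum_(l < N.+2) _ in X in _ = X + _]big_ord_recr /=.
rewrite [\sum_(l < N.+2) _]big_ord_recr /=.
rewrite !subSS !subSn// !subnn !expr0 !fact0 expr1 !mulr1 mul1r.
rewrite ![L0 ^+ N.+3]exprSr.
have := expf_neq0 N.+2 (negbT L0n0); move: (L0 ^+ N.+2) => a a0.
rewrite -!mulrA; congr (_ * (_ * _) + _ * (_ * _)).
  by field; rewrite L0n0 a0.
by field.
Qed.

Lemma omega_le (L0 LF LF0 : R) (M : nat -> R) (N : nat) :
  0 < L0 -> 0 <= LF -> 0 <= LF0 -> 0 <= M N ->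
  N.+2%:R * omega L0 LF LF0 T M N <=
  (LF * T + LF0) * (T * expR (L0 * T)) * (M N * T ^+ N.+1 / (N.+1)`!%:R).
Proof.
move=> L0_gt0 LF_ge0 LF0_ge0 MN; have T0 := ltW T_gt0.
have NE : N.+2%:R != 0 :> R by rewrite pnatr_eq0.
have facE : (T ^+ N.+2 / (N.+2)`!%:R) = T * (T ^+ N.+1 / (N.+1)`!%:R) / N.+2%:R.
  by rewrite exprS factS natrM invfM; ring.
set b := T ^+ N.+1 / (N.+1)`!%:R in facE.
have b0 : 0 <= b by rewrite /b divr_ge0// exprn_ge0.
have E0 := expR_ge0 (L0 * T).
have tail2 : N.+2%:R * exp_tail L0 N.+2 T <= T * expR (L0 * T) * b.
  apply: (le_trans (ler_wpM2l _ (exp_tail_le L0_gt0 N.+2 T0))) => //.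
  by rewrite facE le_eqVlt; apply/orP; left; apply/eqP; field.
have tail3 : N.+2%:R * exp_tail L0 N.+3 T <= T * (T * expR (L0 * T) * b).
  apply: (le_trans (ler_wpM2l _ (exp_tail_le L0_gt0 N.+3 T0))) => //.
  have -> : T ^+ N.+3 / (N.+3)`!%:R = T * (T * b / N.+2%:R) / N.+3%:R.
    by rewrite -facE exprS factS natrM invfM; ring.
  have -> : N.+2%:R * (T * (T * b / N.+2%:R) / N.+3%:R * expR (L0 * T)) =
      T * (T * expR (L0 * T) * b) / N.+3%:R.
    by field; rewrite -!natrD !pnatr_eq0.
  rewrite ler_piMr ?invf_le1 ?ler1n ?ltr0n//.
  by apply: mulr_ge0 => //; apply: mulr_ge0 => //; exact: mulr_ge0.
rewrite omegaE// -[_ * _ / (N.+1)`!%:R]mulrA -/b.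
have h2 := ler_wpM2l (mulr_ge0 LF0_ge0 MN) tail2.
have h3 := ler_wpM2l (mulr_ge0 LF_ge0 MN) tail3.
have := lerD h3 h2; clearbody b.
congr (is_true (_ <= _)); ring.
Qed.

End ErrorEstimates.

Theorem theorem2p3 (R : realType) (U : Type) (T : R) (T_gt0 : 0 < T)
  (x0 : R -> R) (Uad : set (R -> U))
  (f : R -> R -> R -> U -> R) (F : R -> R -> U -> R) (F0 : R -> R)
  (L0 LF LF0 : R) (M : nat -> R)
  (f_smooth : forall (N : nat) (s x : R) (u : U), s \in `[0, T] ->
    exists h : R -> R,
      [/\ is_derive_n_in T N.+1 (fun t => f t s x u) h,
          {within `[0, T], continuous h} &
          forall t : R, t \in `[0, T] -> `|h t| <= M N])
  (L0_gt0 : 0 < L0)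
  (f_lip : forall (t s : R) (u : U), t \in `[0, T] -> s \in `[0, T] ->
    L0.-lipschitz (fun x : R => f t s x u))
  (F_lip : forall (t : R) (u : U), t \in `[0, T] ->
    LF.-lipschitz (fun x : R => F t x u))
  (F0_lip : LF0.-lipschitz F0)
  (c : nat -> nat -> R -> R -> U -> R)
  (remainder : forall (N : nat) (t s x : R) (u : U),
    t \in `[0, T] -> s \in `[0, t] ->
    `|f t s x u - poly_kernel (c N) N t s x u|
      <= M N * t ^+ N.+1 / (N.+1)`!%:R)
  (x : (R -> U) -> R -> R) (xN : nat -> (R -> U) -> R -> R)
  (x_sol : forall u : R -> U, Uad u -> volterra_solution T x0 f u (x u))
  (xN_sol : forall (N : nat) (u : R -> U), Uad u ->
    volterra_solution T x0 (poly_kernel (c N) N) u (xN N u))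
  (F_int : forall u : R -> U, Uad u -> running_cost_integrable T F u (x u))
  (FN_int : forall (N : nat) (u : R -> U), Uad u ->
    running_cost_integrable T F u (xN N u)) :
  let J := cost T F F0 x in
  let JN := fun N : nat => cost T F F0 (xN N) in
  let Jstar := optval Uad J in
  let w := omega L0 LF LF0 T M in
  [/\ (forall N : nat,
        (forall (t s y : R) (v : U), t \in `[0, T] -> s \in `[0, t] ->
          `|f t s y v - poly_kernel (c N) N t s y v|
            <= M N * (t - s) ^+ N.+1 / (N.+1)`!%:R) ->
        forall (eps : R) (u : R -> U), suboptimal Uad (JN N) eps u ->
          ((J u - eps - 2 * w N)%:E <= Jstar)%E /\ (Jstar <= (J u)%:E)%E),
      (forall (N : nat) (eps : R) (u : R -> U), suboptimal Uad (JN N) eps u ->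
          ((J u - eps - 2 * (N.+2%:R * w N))%:E <= Jstar)%E /\
          (Jstar <= (J u)%:E)%E) &
      M N * T ^+ N.+1 / (N.+1)`!%:R @[N --> \oo] --> (0 : R) ->
        (forall (eps : R) (u_ : nat -> R -> U),
          (forall N : nat, (0 < N)%N -> suboptimal Uad (JN N) eps (u_ N)) ->
          forall eta : R, 0 < eta ->
            \forall N \near \oo, (Jstar <= (J (u_ N))%:E)%E /\
              ((J (u_ N))%:E <= Jstar + (eps + eta)%:E)%E) /\
        (forall (eps_ : nat -> R) (u_ : nat -> R -> U),
          (forall N : nat, (0 < N)%N ->
            suboptimal Uad (JN N) (eps_ N) (u_ N)) ->
          eps_ N @[N --> \oo] --> (0 : R) ->
          (J (u_ N))%:E @[N --> \oo] --> Jstar)].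
Proof.
move=> J JN Jstar w.
have TT : T \in `[0, T] by rewrite in_itv/= lexx ltW.
have error N (K : R) (r : R -> R -> R) :
    (forall (t s z : R) (v : U), t \in `[0, T] -> s \in `[0, t] ->
      `|f t s z v - poly_kernel (c N) N t s z v| <= r t s) ->
    (forall t, continuous (r t)) ->
    (forall t, t \in `[0, T] ->
      \int[@lebesgue_measure R]_(s in `[0, t]) r t s
        = K * M N * (t ^+ N.+2 / (N.+2)`!%:R)) ->
    forall u, Uad u -> `|J u - JN N u| <= K * w N.
  move=> rem cr Ir u Uu.
  have -> : K * w N = LF * (K * M N * exp_tail L0 N.+3 T)
                    + LF0 * (K * M N * exp_tail L0 N.+2 T).
    by rewrite /w omegaE//; ring.
  apply: (cost_error T_gt0 L0_gt0 F_lip F0_lip (F_int u Uu) (FN_int N u Uu)).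
  apply: (trajectory_error L0_gt0 f_lip rem _ Ir (x_sol u Uu) (xN_sol N u Uu)).
  by move=> t _; apply: continuous_integrable_itv.
have coarse N (u : R -> U) : Uad u -> `|J u - JN N u| <= N.+2%:R * w N.
  apply: (error N _ (fun t _ => M N * t ^+ N.+1 / (N.+1)`!%:R)).
  - by move=> t s z v; exact: remainder.
  - by move=> t s; exact: cvg_cst.
  - move=> t; rewrite in_itv/= => /andP[t0 _].
    rewrite Rintegral_const//.
    have N2 : N.+2%:R != 0 :> R by rewrite pnatr_eq0.
    rewrite [(N.+2)`!]factS natrM invfM [t ^+ N.+2]exprSr.
    by move: (t ^+ N.+1) _^-1 (N.+2%:R : R) N2 => p k q q0; field.
have transfer N eps u : suboptimal Uad (JN N) eps u ->
    ((J u - eps - 2 * (N.+2%:R * w N))%:E <= Jstar)%E /\ (Jstar <= (J u)%:E)%E.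
  exact: suboptimal_transfer (coarse N).
split => [N sharp eps u|//|aM].
  apply: suboptimal_transfer => v Uv; rewrite -[w N]mul1r.
  apply: (error N 1 (fun t s => M N * ((t - s) ^+ N.+1 / (N.+1)`!%:R))) Uv.
  - by move=> t s z ? tT st; rewrite mulrA; exact: sharp.
  - move=> t s; apply: cvgM; first exact: cvg_cst.
    exact: continuous_shifted_monomial.
  - move=> t; rewrite in_itv/= => /andP[t0 _]; rewrite RintegralZl//.
      by rewrite Rintegral_shifted_monomial// mul1r.
    exact/continuous_integrable_itv/continuous_shifted_monomial.
pose C := (LF * T + LF0) * (T * expR (L0 * T)).
pose a N := M N * T ^+ N.+1 / (N.+1)`!%:R.
have w_le (v : U) N : N.+2%:R * w N <= C * a N.
  apply: omega_le => //.
  - exact: lipschitz_ge0 (F_lip T v TT).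
  - exact: lipschitz_ge0 F0_lip.
  - have O : 0 \in `[0, T] by rewrite in_itv/= lexx ltW.
    have [h [_ _ /(_ 0 O)]] := f_smooth N 0 0 v O.
    exact: le_trans.
have Ca : 2 * (C * a N) @[N --> \oo] --> (0 : R).
  rewrite -(mulr0 2) -(mulr0 C).
  by apply: cvgMl_tmp; apply: cvgMl_tmp.
have upper N eps u : suboptimal Uad (JN N) eps u ->
    (Jstar <= (J u)%:E)%E /\ ((J u - eps - 2 * (C * a N))%:E <= Jstar)%E.
  move=> /transfer[lo ->]; split => //; apply: le_trans lo.
  by rewrite lee_fin lerD2l lerN2 ler_pM2l// (w_le (u T)).
split=> [eps u_ sub eta eta_gt0|eps_ u_ sub eps0].
  near=> N.
  have [|-> lo] := upper N eps (u_ N) (sub N _); first by near: N; exists 1%N.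
  split => //.
  have -> : J (u_ N) = (J (u_ N) - eps - 2 * (C * a N)) + (eps + 2 * (C * a N)).
    ring.
  rewrite EFinD; apply: leeD => //; rewrite lee_fin lerD2l.
  by near: N; apply: cvgr_le Ca _ eta_gt0.
have [hi1 lo1] := upper 1%N _ _ (sub 1%N isT).
have Jfin : Jstar \is a fin_num.
  by rewrite fin_numElt (lt_le_trans (ltNyr _) lo1) (le_lt_trans hi1 (ltry _)).
rewrite -(fineK Jfin); apply: cvg_EFin; first by near=> N.
apply: (@squeeze_cvgr _ _ _ _ (cst (fine Jstar))
  (fun N => fine Jstar + (eps_ N + 2 * (C * a N)))).
- near=> N.
  have [|] := upper N (eps_ N) (u_ N) (sub N _); first by near: N; exists 1%N.
  rewrite -(fineK Jfin) !lee_fin /= => -> ?; lra.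
- exact: cvg_cst.
- rewrite -[X in _ --> X]addr0; apply: cvgD; first exact: cvg_cst.
  by rewrite -[X in _ --> X]addr0; apply: cvgD.
Unshelve. all: by end_near. Qed.
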